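(* Let $(G,B,m,w)$ be a weighted finite graph with boundary such that each connected component of $G$ contains some interior vertices, and put $T=\operatorname{Deg}_B\cdot I_\Omega-A_BL_B^{-1}A_\Omega:\mathbb{R}^\Omega\to\mathbb{R}^\Omega$. Then: (1) for $i=1,2,\dots,|\Omega|$ and $j=0,1,\dots,|\Omega|-i$, $$\nu_i\le\mu_{i+j}(\Omega)+\lambda_{|\Omega|-j}(T),$$ with equality for a pair $i,j$ if and only if there is a nonzero function $u\in\mathbb{R}^\Omega$ such that $\Delta^Nu=\nu_iu$, $\Delta_\Omega u=\mu_{i+j}(\Omega)u$ and $Tu=\lambda_{|\Omega|-j}(T)u$; (2) for $i=1,2,\dots,|\Omega|$ and $j=1,2,\dots,i$, $$\nu_i\ge\mu_{i-j+1}(\Omega)+\lambda_j(T),$$ with equality for a pair $i,j$ if and only if there is a nonzero function $u\in\mathbb{R}^\Omega$ such that $\Delta^Nu=\nu_iu$, $\Delta_\Omega u=\mu_{i-j+1}(\Omega)u$ and $Tu=\lambda_j(T)u$.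
   Context: A weighted finite graph $(G,m,w)$ is a finite simple graph $G$ with vertex set $V$ and edge set $E$, a vertex-measure $m:V\to(0,\infty)$ and an edge-weight $w:E\to(0,\infty)$; $w$ is extended to a symmetric function on $V\times V$ by $w_{xy}=0$ when $\{x,y\}\notin E$. A weighted finite graph with boundary $(G,B,m,w)$ is a weighted finite graph with a nonempty subset $B\subset V$ (the boundary); $\Omega=V\setminus B$ is the interior. $\mathbb{R}^S$ is the space of real functions on $S$, with inner product $\langle u,v\rangle_S=\sum_{x\in S}u(x)v(x)m_x$. For $x\in\Omega$, $\operatorname{Deg}_B(x)=\frac1{m_x}\sum_{y\in B}w_{xy}$; $\operatorname{Deg}_B\cdot I_\Omega$ is multiplication by $\operatorname{Deg}_B$ on $\mathbb{R}^\Omega$. Laplacian: $\Delta u(x)=\frac1{m_x}\sum_{y\in V}(u(x)-u(y))w_{xy}$ for $u\in\mathbb{R}^V$. Laplacian of the interior subgraph: $\Delta_\Omega u(x)=\frac1{m_x}\sum_{y\in\Omega}(u(x)-u(y))w_{xy}$ for $u\in\mathbb{R}^\Omega$, with eigenvalues, counted with multiplicity, $0=\mu_1(\Omega)\le\dots\le\mu_{|\Omega|}(\Omega)$. Neumann Laplacian: for $u\in\mathbb{R}^\Omega$, let $N_0(u)\in\mathbb{R}^V$ be the function with $N_0(u)=u$ on $\Omega$ and $\Delta N_0(u)=0$ on $B$ (unique since each component contains interior vertices). Set $\Delta^N u=(\Delta N_0(u))|_\Omega$, a nonnegative self-adjoint operator on $\mathbb{R}^\Omega$ with eigenvalues (Neumann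 eigenvalues), counted with multiplicity, $0\le\nu_1\le\dots\le\nu_{|\Omega|}$. Weighted adjacency operators: $A_B:\mathbb{R}^B\to\mathbb{R}^\Omega$, $A_Bu(x)=\frac1{m_x}\sum_{y\in B}u(y)w_{xy}$ for $x\in\Omega$, and $A_\Omega:\mathbb{R}^\Omega\to\mathbb{R}^B$, $A_\Omega u(x)=\frac1{m_x}\sum_{y\in\Omega}u(y)w_{xy}$ for $x\in B$. $L_B:\mathbb{R}^B\to\mathbb{R}^B$ is the Dirichlet Laplacian with Dirichlet boundary value on $\Omega$: $L_Bf=(\Delta\tilde f)|_B$, where $\tilde f$ is the extension of $f$ by $0$ on $\Omega$; it is invertible because each component of $G$ contains interior vertices. $T$ is self-adjoint. For a self-adjoint operator $T$ on an $N$-dimensional space, $\lambda_1(T)\le\dots\le\lambda_N(T)$ are its eigenvalues counted with multiplicity. *)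

(* Defs.v *)
(* The field of real numbers is generalized to any real closed field. *)
From HB Require Import structures.
From mathcomp Require Import all_boot all_order all_algebra.
From mathcomp Require Import polyrcf.

Set Implicit Arguments.
Unset Strict Implicit.
Unset Printing Implicit Defensive.

Import Order.TTheory GRing.Theory Num.Theory passmx.
Local Open Scope ring_scope.

(* The space R^S; [R^o] is R seen as a vector space over itself. *)
Notation fct R S := {ffun S -> R^o}.

(** * Eigenvalues counted with multiplicity *)

(* Nondecreasing list of the eigenvalues of [T], each repeated as many times as
   the dimension of its eigenspace.  [rootsR p] is the increasing list of the
   roots of [p]; the list does not depend on the basis, see [count_eigenvals]. *)
Definition eigenvals (R : rcfType) (E : vectType R) (T : 'End(E)) : seq R :=
  flatten [seq nseq (\dim (leigenspace T a)) a
          | a <- rootsR (char_poly (mxof (vbasis fullv) (vbasis fullv) T))].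

(* The k-th smallest eigenvalue; meaningful for k = 1, ..., dim E when [T] is
   self-adjoint, since then [eigenvals T] has dim E entries. *)
Definition eigenval (R : rcfType) (E : vectType R) (T : 'End(E)) (k : nat) : R :=
  nth 0 (eigenvals T) k.-1.

Lemma eigenvals_sorted (R : rcfType) (E : vectType R) (T : 'End(E)) :
  sorted <=%R (eigenvals T).
Proof.
rewrite /eigenvals; set r := rootsR _.
have: sorted <%R r by apply: sorted_roots.
rewrite (sorted_pairwise lt_trans) (sorted_pairwise le_trans).
elim: r => //= a r IHr /andP[/allP ltar /IHr {}IHr].
rewrite pairwise_cat IHr andbT; apply/andP; split.
  apply/allrelP => x y /nseqP[-> _] /flatten_mapP[b br /nseqP[-> _]].
  exact/ltW/ltar.
by elim: (\dim _) => //= n ->; rewrite andbT; apply/allP => x /nseqP[-> _].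
Qed.

Lemma count_eigenvals (R : rcfType) (E : vectType R) (T : 'End(E)) (a : R) :
  count_mem a (eigenvals T) = \dim (leigenspace T a).
Proof.
rewrite /eigenvals; set p := char_poly _.
have p0 : p != 0 by rewrite monic_neq0 ?char_poly_monic.
have ur : uniq (rootsR p) by apply: uniq_roots.
have memr : (a \in rootsR p) = root p a.
  by have := roots_on_rootsR p0 a; rewrite in_itv.
rewrite count_flatten -map_comp.
rewrite (eq_map (g := fun b => (b == a) * \dim (leigenspace T a))%N); last first.
  by move=> b /=; rewrite count_nseq /=; case: eqP => [->|].
have -> : sumn [seq (b == a) * \dim (leigenspace T a) | b <- rootsR p]%N
        = ((a \in rootsR p) * \dim (leigenspace T a))%N.
  elim: (rootsR p) ur => //= b r IHr /andP[bNr /IHr ->].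
  rewrite inE eq_sym; case: eqP bNr => [->|_ _]; last by rewrite mul0n.
  by move/negPf->; rewrite mul0n addn0.
rewrite memr; case: (boolP (root p a)) => [_|]; first by rewrite mul1n.
rewrite -eigenvalue_root_char negbK => /eqP e0.
rewrite (leigenspaceE (vbasisP fullv)) e0 mul0n.
suff -> : vsof (vbasis fullv) (0 : 'M[R]_(\dim {:E})) = 0%VS by rewrite dimv0.
by apply/eqP; rewrite vsof_eq0 ?vbasisP.
Qed.

(** * Weighted finite graphs *)

(* [wt] is the edge-weight already extended by 0 to V x V. *)
Record wgraph (R : rcfType) (V : finType) := WGraph {
  edge : rel V;
  edge_sym : symmetric edge;
  edge_irr : irreflexive edge;
  msr : V -> R;
  msr_gt0 : forall x, 0 < msr x;
  wt : V -> V -> R;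
  wt_sym : forall x y, wt x y = wt y x;
  wt_gt0 : forall x y, edge x y -> 0 < wt x y;
  wt_eq0 : forall x y, ~~ edge x y -> wt x y = 0 }.

Notation bd_pts B := {x | x \in B}.
Notation int_pts B := {x | x \notin B}.

Definition components_meet_interior (R : rcfType) (V : finType)
    (G : wgraph R V) (B : {set V}) : Prop :=
  forall x : V, exists2 y : V, y \notin B & connect (edge G) x y.

Section Operators.
Context (R : rcfType) (V : finType) (G : wgraph R V) (B : {set V}).

Local Notation m := (msr G).
Local Notation w := (wt G).

Definition restr_fun (P : pred V) (u : fct R V) : fct R {x | P x} :=
  [ffun x => u (val x)].
Definition ext0_fun (P : pred V) (u : fct R {x | P x}) : fct R V :=
  [ffun x => if insub x is Some y then u y else 0].

Definition lap_fun (u : fct R V) : fct R V :=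
  [ffun x => (m x)^-1 * \sum_(y : V) (u x - u y) * w x y].

Definition lap_int_fun (u : fct R (int_pts B)) : fct R (int_pts B) :=
  [ffun x => (m (val x))^-1 *
     \sum_(y : int_pts B) (u x - u y) * w (val x) (val y)].

Definition degB (x : int_pts B) : R :=
  (m (val x))^-1 * \sum_(y : bd_pts B) w (val x) (val y).
Definition mul_degB_fun (u : fct R (int_pts B)) : fct R (int_pts B) :=
  [ffun x => degB x * u x].

Definition adjB_fun (u : fct R (bd_pts B)) : fct R (int_pts B) :=
  [ffun x => (m (val x))^-1 * \sum_(y : bd_pts B) u y * w (val x) (val y)].
Definition adjI_fun (u : fct R (int_pts B)) : fct R (bd_pts B) :=
  [ffun x => (m (val x))^-1 * \sum_(y : int_pts B) u y * w (val x) (val y)].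

(* The left-hand side of the linear system [v = u on the interior, Delta v = 0
   on B] which determines [v = N_0(u)]. *)
Definition neumann_sys_fun (v : fct R V) : fct R V :=
  [ffun x => if x \in B then lap_fun v x else v x].

Fact restr_is_linear P : linear (@restr_fun P).
Proof. by move=> a u v; apply/ffunP => x; rewrite !ffunE. Qed.
HB.instance Definition _ (P : pred V) :=
  GRing.isLinear.Build R (fct R V) (fct R {x | P x})
  *:%R (@restr_fun P) (@restr_is_linear P).

Fact ext0_is_linear P : linear (@ext0_fun P).
Proof.
move=> a u v; apply/ffunP => x; rewrite !ffunE.
by case: insub => [y|]; rewrite ?ffunE // scaler0 addr0.
Qed.
HB.instance Definition _ (P : pred V) :=
  GRing.isLinear.Build R (fct R {x | P x}) (fct R V)
  *:%R (@ext0_fun P) (@ext0_is_linear P).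

Let sum_lin (I : finType) (c a : R) (f g h : I -> R) :
  (forall i, h i = a * f i + g i) ->
  c * (\sum_i h i) = a * (c * \sum_i f i) + c * \sum_i g i.
Proof.
move=> hE; rewrite (eq_bigr _ (fun i _ => hE i)) big_split /= -mulr_sumr.
by rewrite mulrDr mulrCA.
Qed.

Let lin1 (a p q r s t : R) :
  (a * p + q - (a * r + s)) * t = a * ((p - r) * t) + (q - s) * t.
Proof.
by rewrite opprD addrACA mulrDl -mulrBr mulrA.
Qed.

Fact lap_is_linear : linear lap_fun.
Proof.
move=> a u v; apply/ffunP => x; rewrite !ffunE.
by apply: sum_lin => y; rewrite !ffunE; apply: lin1.
Qed.
HB.instance Definition _ := GRing.isLinear.Build R (fct R V) (fct R V)
  *:%R lap_fun lap_is_linear.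

Fact lap_int_is_linear : linear lap_int_fun.
Proof.
move=> a u v; apply/ffunP => x; rewrite !ffunE.
by apply: sum_lin => y; rewrite !ffunE; apply: lin1.
Qed.
HB.instance Definition _ :=
  GRing.isLinear.Build R (fct R (int_pts B)) (fct R (int_pts B))
    *:%R lap_int_fun lap_int_is_linear.

Fact mul_degB_is_linear : linear mul_degB_fun.
Proof.
move=> a u v; apply/ffunP => x; rewrite !ffunE.
by rewrite mulrDr; congr (_ + _); apply: mulrCA.
Qed.
HB.instance Definition _ :=
  GRing.isLinear.Build R (fct R (int_pts B)) (fct R (int_pts B))
    *:%R mul_degB_fun mul_degB_is_linear.

Fact adjB_is_linear : linear adjB_fun.
Proof.
move=> a u v; apply/ffunP => x; rewrite !ffunE.
by apply: sum_lin => y; rewrite !ffunE mulrDl -mulrA.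
Qed.
HB.instance Definition _ :=
  GRing.isLinear.Build R (fct R (bd_pts B)) (fct R (int_pts B))
    *:%R adjB_fun adjB_is_linear.

Fact adjI_is_linear : linear adjI_fun.
Proof.
move=> a u v; apply/ffunP => x; rewrite !ffunE.
by apply: sum_lin => y; rewrite !ffunE mulrDl -mulrA.
Qed.
HB.instance Definition _ :=
  GRing.isLinear.Build R (fct R (int_pts B)) (fct R (bd_pts B))
    *:%R adjI_fun adjI_is_linear.

Fact neumann_sys_is_linear : linear neumann_sys_fun.
Proof.
move=> a u v; apply/ffunP => x.
by rewrite [LHS]ffunE linearP !ffunE; case: ifP.
Qed.
HB.instance Definition _ := GRing.isLinear.Build R (fct R V) (fct R V)
  *:%R neumann_sys_fun neumann_sys_is_linear.

(* [lap] is Delta, [lap_int] is Delta_Omega, [adjB] is A_B, [adjI] is A_Omega,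
   [lap_dir] is L_B, [neumann_ext] is N_0, [lap_neu] is Delta^N, [opT] is T. *)
Definition restr (P : pred V) : 'Hom(fct R V, fct R {x | P x}) :=
  linfun (@restr_fun P).
Definition ext0 (P : pred V) : 'Hom(fct R {x | P x}, fct R V) :=
  linfun (@ext0_fun P).
Definition lap : 'End(fct R V) := linfun lap_fun.
Definition lap_int : 'End(fct R (int_pts B)) := linfun lap_int_fun.
Definition mul_degB : 'End(fct R (int_pts B)) := linfun mul_degB_fun.
Definition adjB : 'Hom(fct R (bd_pts B), fct R (int_pts B)) := linfun adjB_fun.
Definition adjI : 'Hom(fct R (int_pts B), fct R (bd_pts B)) := linfun adjI_fun.

Definition lap_dir : 'End(fct R (bd_pts B)) :=
  (restr (fun x => x \in B) \o lap \o ext0 (fun x => x \in B))%VF.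

(* See [neumann_extP] for the defining property of N_0. *)
Definition neumann_ext : 'Hom(fct R (int_pts B), fct R V) :=
  ((linfun neumann_sys_fun)^-1 \o ext0 (fun x => x \notin B))%VF.

Definition lap_neu : 'End(fct R (int_pts B)) :=
  (restr (fun x => x \notin B) \o lap \o neumann_ext)%VF.

Definition opT : 'End(fct R (int_pts B)) :=
  (mul_degB - (adjB \o lap_dir^-1 \o adjI))%VF.

Lemma lap_energy (v : fct R V) :
  \sum_x (m x * (v x * lap v x)) *+ 2
  = \sum_x \sum_y w x y * (v x - v y) ^+ 2.
Proof.
pose F x y : R := v x * ((v x - v y) * w x y).
have E x : m x * (v x * lap v x) = \sum_y F x y.
  rewrite lfunE /= ffunE /F -mulr_sumr mulrCA; congr (_ * _).
  by rewrite mulrA mulfV ?mul1r // gt_eqF ?msr_gt0.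
have E2 (a b c : R) : a * ((a - b) * c) + b * ((b - a) * c) = c * (a - b) ^+ 2.
  by rewrite expr2 ![_ * (_ * c)]mulrA -mulrDl mulrC -[b - a]opprB mulrN -mulrBl.
under eq_bigr do rewrite E.
rewrite sumrMnl mulr2n {2}exchange_big -big_split /=; apply: eq_bigr => x _.
by rewrite -big_split; apply: eq_bigr => y _; rewrite /F [w y x]wt_sym; apply: E2.
Qed.

Context (meet_int : components_meet_interior G B).

Lemma harmonic_eq0 (v : fct R V) :
  (forall x, x \notin B -> v x = 0) -> (forall x, x \in B -> lap v x = 0) ->
  v = 0.
Proof.
move=> v0 lv0; have E := lap_energy v; move: E.
rewrite big1 => [/esym/eqP|x _]; last first.
  by case: (boolP (x \in B)) => [/lv0|/v0] ->;
    rewrite ?(mulr0, mul0r) ?mulr0 mul0rn.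
have w0 x y : 0 <= w x y.
  by case: (boolP (edge G x y)) => [/wt_gt0/ltW|/wt_eq0->].
have p0 x y : 0 <= w x y * (v x - v y) ^+ 2 by rewrite mulr_ge0 ?sqr_ge0.
rewrite psumr_eq0 => [/allP vE|x _]; last by apply: sumr_ge0.
have vedge x y : edge G x y -> v x = v y.
  move=> exy; have := vE x (mem_index_enum _); rewrite psumr_eq0 //.
  move=> /allP/(_ y (mem_index_enum _)).
  by rewrite mulf_eq0 gt_eqF ?wt_gt0 //= sqrf_eq0 subr_eq0 => /eqP.
apply/ffunP => x; rewrite ffunE; have [y yB /connectP[p]] := meet_int x.
elim: p x => [|z p IHp] x /=; first by move=> _ <-; apply: v0.
by move=> /andP[/vedge-> pzp] /(IHp _ pzp).
Qed.

Lemma lker_neumann_sys : lker (linfun neumann_sys_fun) == 0%VS.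
Proof.
apply/eqP/vspaceP => v; rewrite memv0 memv_ker lfunE /=.
apply/eqP/eqP => [/ffunP vE|->]; last by rewrite linear0.
apply: harmonic_eq0 => x xB; have := vE x; rewrite !ffunE.
  by rewrite (negPf xB).
by rewrite xB lfunE /= ffunE.
Qed.

(* [neumann_ext u] is the unique function equal to [u] on the interior and
   harmonic on the boundary. *)
Lemma neumann_extP (u : fct R (int_pts B)) (v : fct R V) :
  v = neumann_ext u <->
  (forall x : int_pts B, v (val x) = u x) /\ (forall x, x \in B -> lap v x = 0).
Proof.
have K := lker0_lfunK lker_neumann_sys.
have VK : cancel (linfun neumann_sys_fun)^-1%VF (linfun neumann_sys_fun).
  exact: lker0_lfunVK lker_neumann_sys.
rewrite /neumann_ext comp_lfunE; split=> [->|[vu lv]]; last first.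
  apply: (can_inj K); rewrite VK; apply/ffunP => x; rewrite !lfunE /= !ffunE.
  case: insubP => [y yB yx|]; first by rewrite -yx (negPf (valP y)) vu.
  by rewrite negbK => xB; rewrite xB; have := lv x xB; rewrite lfunE /= ffunE.
set z := (_^-1)%VF _.
have /ffunP zE : neumann_sys_fun z = ext0_fun (P := fun x => x \notin B) u.
  by have := VK (ext0 (fun x => x \notin B) u); rewrite -/z lfunE [RHS]lfunE.
split=> [x|x xB].
  by have := zE (val x); rewrite !ffunE (negPf (valP x)) valK.
have := zE x; rewrite [neumann_sys_fun _ _]ffunE xB [X in _ = X -> _]ffunE.
by rewrite insubF ?xB // lfunE.
Qed.

(* [L_B] is invertible, so that [lap_dir^-1] in [opT] is its inverse. *)
Lemma lker_lap_dir : lker lap_dir == 0%VS.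
Proof.
apply/eqP/vspaceP => f; rewrite memv0 memv_ker.
apply/eqP/eqP => [/ffunP fE|->]; last by rewrite linear0.
have /ffunP e0 : ext0_fun f = 0.
  apply: harmonic_eq0 => x xB; first by rewrite ffunE insubF ?(negPf xB).
  by have := fE (Sub x xB); rewrite !comp_lfunE lfunE !ffunE /= [ext0 _ _]lfunE.
by apply/ffunP => x; have := e0 (val x); rewrite !ffunE valK.
Qed.

End Operators.

(* Main.v *)
Require Import Defs.
From mathcomp Require Import all_boot all_order all_algebra.
From mathcomp Require Import polyrcf complex zify ring lra.

Set Implicit Arguments.
Unset Strict Implicit.
Unset Printing Implicit Defensive.

Import Order.TTheory GRing.Theory Num.Theory passmx.
Local Open Scope ring_scope.

(* Eliminating the boundary values of [N_0(u)] gives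
   [Delta^N = Delta_Omega + T], a sum of two self-adjoint operators, so the
   theorem is Weyl's inequality with its equality case.  For Weyl, span the
   eigenvectors of one operator with eigenvalues at least its [i]-th one, and
   similarly for the two others, so that the three dimensions add up to more
   than twice that of the space; a nonzero vector common to the three spans
   compares the Rayleigh quotients, and in the equality case each Rayleigh
   quotient is extremal on its span, which makes the vector an eigenvector of
   all three operators. *)

(** * Split polynomials over a real closed field *)

Lemma eqp_prod_XsubC_of_no_sum2_squares (R : rcfType) (p : {poly R}) :
  p != 0 -> (forall a b : R, ~~ (('X - a%:P) ^+ 2 + (b ^+ 2)%:P %| p)) ->
  exists2 rs : seq R, uniq rs & p %= \prod_(r <- rs) ('X - r%:P).
Proof.
have [n] := ubnP (size p); elim: n p => // n IHn p szp p0 pN.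
have [/eqP sz1|sz1] := boolP (size p == 1%N).
  by exists [::]; rewrite // big_nil -size_poly_eq1 sz1.
pose toC := real_complex R.
have [z pz] : exists z, root (map_poly toC p) z.
  by apply/closed_rootP; rewrite size_map_poly.
have pzJ : root (map_poly toC p) z^*%C.
  rewrite -complex_root_conj -map_poly_comp; congr (root _ _): pz.
  by apply: eq_map_poly => x /=; rewrite oppr0.
have zR : complex.Im z = 0.
  apply/eqP; apply: contraNT (pN (complex.Re z) (complex.Im z)) => Iz.
  rewrite -(dvdp_map toC).
  have -> : map_poly toC (('X - (complex.Re z)%:P) ^+ 2
                           + (complex.Im z ^+ 2)%:P)
      = ('X - z%:P) * ('X - z^*%C%:P).
    have eD : z + z^*%C = (complex.Re z + complex.Re z)%:C%C.
      by case: z {pz pzJ Iz} => a b; apply/eqP; rewrite eq_complex /= subrr !eqxx.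
    have eM : z * z^*%C = (complex.Re z ^+ 2 + complex.Im z ^+ 2)%:C%C.
      by case: z {pz pzJ Iz eD} => a b; congr (_ +i* _)%C => /=; ring.
    have -> : ('X - z%:P) * ('X - z^*%C%:P) =
        'X ^+ 2 - (z + z^*%C)%:P * 'X + (z * z^*%C)%:P :> {poly R[i]}.
      by rewrite !rmorphD /= !rmorphM /=; ring.
    rewrite eD eM !(rmorphD, rmorphN, rmorphXn, rmorphM) /=.
    by rewrite map_polyX !map_polyC /=; ring.
  rewrite Gauss_dvdp -?root_factor_theorem -?dvdp_XsubCl ?dvdp_XsubCl ?pz ?pzJ //.
  rewrite coprimep_XsubC root_XsubC eq_sym.
  apply: contra Iz => /eqP/(congr1 (@complex.Im R)).
  by case: (z) => a b /= bE; apply/eqP; lra.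
have {zR}zE : z = toC (complex.Re z) by case: (z) zR => a b /= ->.
move: pz; rewrite zE fmorph_root; set a := complex.Re z.
move=> /factor_theorem[q pE].
have q0 : q != 0 by apply: contraNneq p0 => q0; rewrite pE q0 mul0r.
have [|//|c b|rs urs qE] := IHn q.
- by move: szp; rewrite pE size_Mmonic ?monicXsubC // size_XsubC addn2 ltnS.
- by apply: contra (pN c b) => /dvdp_trans; apply; rewrite pE dvdp_mulr.
exists (a :: rs); last by rewrite big_cons pE mulrC eqp_mull.
(* If [a] were again a root of [q], [('X - a) ^+ 2] would divide [p]. *)
rewrite /= urs andbT; apply: contra (pN a 0) => ars.
rewrite expr0n /= addr0 pE expr2 dvdp_mul // (eqp_dvdr _ qE).
by rewrite dvdp_XsubCl root_prod_XsubC.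
Qed.

(** * Inner products and diagonalization of self-adjoint matrices *)

Record inner_product (R : rcfType) (E : lmodType R) (f : E -> E -> R) : Prop :=
  InnerProduct {
    inner_linear : forall a u v w, f (a *: u + v) w = a * f u w + f v w;
    inner_sym : forall u v, f u v = f v u;
    inner_gt0 : forall u, u != 0 -> 0 < f u u }.

Section InnerProduct.
Context (R : rcfType) (E : lmodType R) (f : E -> E -> R).
Hypothesis fP : inner_product f.

Lemma inner0l v : f 0 v = 0.
Proof.
by have := inner_linear fP (-1) 0 0 v; rewrite scaler0 addr0; lra.
Qed.

Lemma innerDl u v w : f (u + v) w = f u w + f v w.
Proof. by have := inner_linear fP 1 u v w; rewrite scale1r mul1r. Qed.

Lemma innerZl a u v : f (a *: u) v = a * f u v.
Proof. by have := inner_linear fP a u 0 v; rewrite inner0l !addr0. Qed.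

Lemma innerBl u v w : f (u - v) w = f u w - f v w.
Proof. by rewrite innerDl -scaleN1r innerZl mulN1r. Qed.

Lemma innerDr u v w : f u (v + w) = f u v + f u w.
Proof. by rewrite !(inner_sym fP u) innerDl. Qed.

Lemma innerZr a u v : f u (a *: v) = a * f u v.
Proof. by rewrite !(inner_sym fP u) innerZl. Qed.

Lemma inner_eq0 u : (f u u == 0) = (u == 0).
Proof.
apply/eqP/eqP => [|->]; last exact: inner0l.
by move=> fu0; apply: contra_eq fu0 => /(inner_gt0 fP); rewrite lt_def => /andP[].
Qed.

Lemma inner_ge0 u : 0 <= f u u.
Proof.
by have [->|/(inner_gt0 fP)/ltW //] := eqVneq u 0; rewrite inner0l.
Qed.

End InnerProduct.

(* A self-adjoint [S] and [b : R] satisfy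
   [f ((S^2 + b^2) w) w = f (S w) (S w) + b^2 f w w], so the factor
   [('X - a)^2 + b^2] of a polynomial annihilating [M] may be replaced by the
   factor ['X - a], of smaller degree. *)
Lemma selfadjoint_mx_diagonalizable (R : rcfType) (n : nat) (M : 'M[R]_n)
    (f : 'rV[R]_n -> 'rV[R]_n -> R) :
  inner_product f -> (forall u v, f (u *m M) v = f u (v *m M)) ->
  diagonalizable M.
Proof.
case: n M f => [|n] M f fP fM.
  by apply/diagonalizablePeigen; exists [::]; rewrite ?big_nil // thinmx0.
have p0 : mxminpoly M != 0 by rewrite monic_neq0 ?mxminpoly_monic.
have [|rs urs pE] := eqp_prod_XsubC_of_no_sum2_squares p0; last first.
  by apply/diagonalizableP; exists rs; rewrite // (eqp_dvdl _ pE).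
move=> a b; apply/negP => /dvdpP[q qE].
have q0 : q != 0 by apply: contraNneq p0 => q0; rewrite qE q0 mul0r.
suff /mxminpoly_min : horner_mx M (q * ('X - a%:P)) = 0.
  move=> /dvdp_leq; rewrite mulf_neq0 ?polyXsubC_eq0 // => /(_ isT).
  have Q3 : size (('X - a%:P) ^+ 2 + (b ^+ 2)%:P) = 3%N.
    by rewrite size_polyDl size_exp_XsubC // (leq_ltn_trans (size_polyC_leq1 _)).
  have Q0 : ('X - a%:P) ^+ 2 + (b ^+ 2)%:P != 0 by rewrite -size_poly_eq0 Q3.
  rewrite qE !size_mul ?polyXsubC_eq0 // Q3 size_XsubC addn3 addn2 /=.
  by rewrite ltnn.
have := mx_root_minpoly M; rewrite qE rmorphM [horner_mx M (q * _)]rmorphM rmorphD rmorphXn rmorphB /=.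
rewrite horner_mx_X !horner_mx_C; set S := M - a%:M; set N := horner_mx M q.
(* For a row [w] of [N], pairing [w (S^2 + b^2) = 0] with [w] gives a zero sum of two nonnegative
   terms, so [w S = 0]. *)
move=> NS0; apply/row_matrixP => i; rewrite row_mul row0; set w := row i N.
have fS u v : f (u *m S) v = f u (v *m S).
  by rewrite !mulmxBr !mul_mx_scalar -!scaleNr !innerDl ?innerDr ?innerZl
    ?innerZr ?fM.
have : f (w *m (S ^+ 2 + (b ^+ 2)%:M)) w = 0.
  by rewrite -row_mul mulmxE NS0 row0 inner0l.
rewrite mulmxDr mul_mx_scalar innerDl // innerZl // expr2 -mulmxE mulmxA fS => H.
apply/eqP; rewrite -(inner_eq0 fP).
have h1 := inner_ge0 fP (w *m S).
have h2 : 0 <= b ^+ 2 * f w w by rewrite mulr_ge0 ?sqr_ge0 ?inner_ge0.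
by apply/eqP; move: H h1 h2; clear; lra.
Qed.

(** * Spectral theorem for self-adjoint operators *)

Section SelfAdjoint.
Context (R : rcfType) (E : vectType R) (f : E -> E -> R).
Hypothesis fP : inner_product f.

Definition self_adjoint (T : 'End(E)) := forall u v, f (T u) v = f u (T v).

Lemma leigenspaceP (T : 'End(E)) a u :
  reflect (T u = a *: u) (u \in leigenspace T a).
Proof.
rewrite memv_ker add_lfunE opp_lfunE scale_lfunE id_lfunE subr_eq0.
exact: eqP.
Qed.

Lemma sum_leigenspace_stable (T : 'End(E)) (s : seq R) u :
  u \in (\sum_(a <- s) leigenspace T a)%VS ->
  T u \in (\sum_(a <- s) leigenspace T a)%VS.
Proof.
elim: s u => [|a s IHs] u; first by rewrite big_nil !memv0 => /eqP->; rewrite linear0.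
rewrite big_cons => /memv_addP[v /[dup] va /leigenspaceP vE [w ws ->]].
by rewrite (linearD T) /= vE memv_add ?memvZ ?IHs.
Qed.

Section OneOperator.
Context (T : 'End(E)).
Hypothesis Tsa : self_adjoint T.

(** For an eigenvector [x] for [b], self-adjointness gives [(a - b) * f u x = 0]. *)
Lemma leigenspace_orthogonal a (s : seq R) u v :
  a \notin s -> u \in leigenspace T a ->
  v \in (\sum_(b <- s) leigenspace T b)%VS -> f u v = 0.
Proof.
move=> + /leigenspaceP uE; elim: s v => [|b s IHs] v.
  by rewrite big_nil memv0 => _ /eqP->; rewrite (inner_sym fP) inner0l.
rewrite inE negb_or big_cons => /andP[ab aNs].
move=> /memv_addP[x /leigenspaceP xE [y /(IHs _ aNs) fuy ->]].
rewrite innerDr // fuy addr0.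
have /eqP := Tsa u x; rewrite uE xE innerZl // innerZr // -subr_eq0 -mulrBl.
by rewrite mulf_eq0 subr_eq0 (negPf ab) => /eqP.
Qed.

Lemma dim_sum_leigenspace (s : seq R) : uniq s ->
  \dim (\sum_(a <- s) leigenspace T a)%VS
  = (\sum_(a <- s) \dim (leigenspace T a))%N.
Proof.
elim: s => [|a s IHs] /=; first by rewrite !big_nil dimv0.
move=> /andP[aNs /IHs {}IHs]; rewrite !big_cons dimv_disjoint_sum ?IHs //.
apply/eqP; rewrite -subv0; apply/subvP => v; rewrite memv_cap memv0.
move=> /andP[va vs]; rewrite -(inner_eq0 fP); apply/eqP.
exact: leigenspace_orthogonal aNs va vs.
Qed.

(* Rayleigh quotients; [d] is [1] for the bound from above and [-1] for the
   bound from below. *)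
Lemma rayleigh_sum_leigenspace (d c : R) (s : seq R) u : d != 0 -> uniq s ->
  (forall a, a \in s -> 0 <= d * (c - a)) ->
  u \in (\sum_(a <- s) leigenspace T a)%VS ->
  0 <= d * f (c *: u - T u) u /\ (f (c *: u - T u) u = 0 -> T u = c *: u).
Proof.
move=> d0; elim: s u => [|a s IHs] u /=.
  rewrite big_nil memv0 => _ _ /eqP->.
  by rewrite (linear0 T) scaler0 subrr inner0l // mulr0.
move=> /andP[aNs us] ds; rewrite big_cons.
move=> /memv_addP[v va [w ws ->]].
have [|ge0 eq0] := IHs w us _ ws.
  by move=> b bs; apply: ds; rewrite inE bs orbT.
have vE := leigenspaceP _ _ _ va.
have fvw : f v w = 0 := leigenspace_orthogonal aNs va ws.
have fvTw : f v (T w) = 0.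
  exact: leigenspace_orthogonal aNs va (sum_leigenspace_stable ws).
have -> : f (c *: (v + w) - T (v + w)) (v + w)
    = (c - a) * f v v + f (c *: w - T w) w.
  rewrite (linearD T) /= vE !(innerBl fP, innerDl fP, innerZl fP, innerDr fP).
  by rewrite !(inner_sym fP _ v) fvw fvTw; ring.
have dca : 0 <= d * (c - a) by apply: ds; rewrite mem_head.
have := inner_ge0 fP v; rewrite mulrDr mulrA => fvv.
have dv : 0 <= d * (c - a) * f v v by rewrite mulr_ge0.
split=> [|H]; first by rewrite addr_ge0.
(* Two nonnegative terms with sum zero both vanish: either [c = a] or [v = 0], and the induction
   hypothesis handles [w]. *)
have := congr1 (fun x => d * x) H; rewrite mulr0 mulrDr mulrA => /eqP.
rewrite paddr_eq0 // !mulf_eq0 (negPf d0) /= subr_eq0 inner_eq0 //.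
move=> /andP[cv /eqP/eq0 wE]; rewrite (linearD T) /= wE scalerDr vE; congr (_ + _).
by move: cv => /orP[/eqP->|/eqP->] //; rewrite !scaler0.
Qed.

Let evs := rootsR (char_poly (mxof (vbasis fullv) (vbasis fullv) T)).

Let uniq_evs : uniq evs. Proof. exact: uniq_roots. Qed.

(** The operator and the inner product are transported to row vectors through a basis, where the
    matrix is diagonalizable. *)
Lemma sum_leigenspace_full : (\sum_(a <- evs) leigenspace T a)%VS = fullv.
Proof.
pose e := vbasis {:E}; have eB : basis_of {:E} e := vbasisP _.
pose M := mxof e e T.
pose g (u v : 'rV_(\dim {:E})) := f (vecof e u) (vecof e v).
have TM u : vecof e (u *m M) = T (vecof e u) by rewrite mul_mxof rVofK.
have gP : inner_product g.
  split=> [a u v w|u v|u u0]; rewrite /g.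
  - by rewrite linearP (inner_linear fP).
  - by rewrite (inner_sym fP).
  - by rewrite (inner_gt0 fP) // vecof_eq0.
have /diagonalizablePeigen[rs urs rsE] : diagonalizable M.
  by apply: (selfadjoint_mx_diagonalizable gP) => u v; rewrite /g !TM Tsa.
set W := (\sum_(a <- evs) _)%VS.
apply/eqP; rewrite eqEsubv subvf /=; apply/subvP => v _.
rewrite -[v](rVofK eB) (mem_vecof eB) (submx_trans (submx1 _)) // -rsE.
elim: (rs) => [|r s IHs]; first by rewrite big_nil sub0mx.
rewrite big_cons addsmx_sub IHs andbT -(vsof_sub eB) -(leigenspaceE eB).
have [rs0|] := boolP (r \in evs).
  by rewrite /W (big_rem r) //= addvSl.
(* A scalar outside [evs] does not occur in [eigenvals T], so its eigenspace has dimension 0. *)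
move=> rN; suff -> : leigenspace T r = 0%VS by rewrite sub0v.
apply/eqP; rewrite -dimv_eq0 -count_eigenvals eqn0Ngt -has_count.
apply: contra rN => /hasP[x + /eqP xr]; rewrite xr => /flatten_mapP[b br].
by move=> /nseqP[->].
Qed.

Lemma count_eigenvals_dim (P : pred R) :
  \dim (\sum_(a <- [seq a <- evs | P a]) leigenspace T a)%VS
  = count P (eigenvals T).
Proof.
rewrite dim_sum_leigenspace ?filter_uniq // /eigenvals -/evs.
elim: (evs) => [|a s IHs] /=; first by rewrite big_nil.
rewrite count_cat count_nseq -IHs; case: ifP => _; rewrite ?big_cons ?mul1n //.
Qed.

Lemma size_eigenvals : size (eigenvals T) = \dim {:E}.
Proof.
by rewrite -count_predT -count_eigenvals_dim filter_predT sum_leigenspace_full.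
Qed.

(** * Subspaces with bounded Rayleigh quotient *)

(** For [d = 1] the Rayleigh quotient of [T] is at most [c] on [U], for [d = -1] at least [c]; in
    both cases it equals [c] only at eigenvectors. *)
Definition rayleigh_bound (d c : R) (U : {vspace E}) := forall u, u \in U ->
  0 <= d * f (c *: u - T u) u /\ (f (c *: u - T u) u = 0 -> T u = c *: u).

(** [U] is spanned by the eigenvectors with eigenvalue at most the [k]-th one; the first [k] entries
    of the sorted list all qualify. *)
Lemma rayleigh_below k : (0 < k <= \dim {:E})%N ->
  exists2 U, (k <= \dim U)%N & rayleigh_bound 1 (eigenval T k) U.
Proof.
(* From here [k] is the zero-based index in the list of eigenvalues. *)
case: k => // k; rewrite -size_eigenvals /= /eigenval /= => kN.
set c := nth _ _ _.
exists (\sum_(a <- [seq a <- evs | (a <= c)%R]) leigenspace T a)%VS.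
  rewrite count_eigenvals_dim ltnNge; apply/negP => h.
  have := nth_count_gt 0 (eigenvals_sorted T).
  by move=> /(_ c k); rewrite h kN => /(_ isT); rewrite ltxx.
move=> u uU; apply: rayleigh_sum_leigenspace uU; rewrite ?oner_eq0 ?filter_uniq //.
by move=> a; rewrite mem_filter mul1r subr_ge0 => /andP[].
Qed.

(** Fewer than [k] entries of the sorted list lie strictly below the [k]-th one; the eigenvectors
    for the remaining entries span [U]. *)
Lemma rayleigh_above k : (0 < k <= \dim {:E})%N ->
  exists2 U, (\dim {:E} < \dim U + k)%N & rayleigh_bound (-1) (eigenval T k) U.
Proof.
case: k => // k; rewrite -size_eigenvals /= /eigenval /= => kN.
set c := nth _ _ _.
exists (\sum_(a <- [seq a <- evs | (c <= a)%R]) leigenspace T a)%VS.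
  rewrite count_eigenvals_dim -(count_predC (>= c)%R) addnS ltnS leq_add2l.
  rewrite leqNgt; apply/negP => h.
  have := nth_count_lt (x := c) 0 (eigenvals_sorted T) (i := k).
  rewrite ltxx => /(_ _)/negP; apply => //.
  by apply: leq_trans h _; rewrite (eq_count (a2 := < c)%O) // => x /=; rewrite ltNge.
move=> u uU; apply: rayleigh_sum_leigenspace uU;
  rewrite ?oppr_eq0 ?oner_eq0 ?filter_uniq //.
by move=> a; rewrite mem_filter mulN1r opprB subr_ge0 => /andP[].
Qed.

End OneOperator.

(** * Weyl's inequalities and their equality cases *)

Lemma cap3_neq0 (U V W : {vspace E}) :
  (\dim {:E} + \dim {:E} < \dim U + \dim V + \dim W)%N ->
  exists u, [/\ u != 0, u \in U, u \in V & u \in W].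
Proof.
move=> dUVW; have D1 := dimv_sum_cap U V; have D2 := dimv_sum_cap (U :&: V) W.
have D3 := dimvS (subvf (U + V)); have D4 := dimvS (subvf (U :&: V + W)).
have : (U :&: V :&: W)%VS != 0%VS.
  rewrite -dimv_eq0 -lt0n -(ltn_add2l (\dim {:E} + \dim {:E})) addn0.
  apply: leq_trans dUVW _; rewrite -D1 -addnA -D2 addnA leq_add2r.
  exact: leq_add.
rewrite -vpick0; set u := vpick _ => u0; exists u.
by have := memv_pick (U :&: V :&: W); rewrite !memv_cap => /andP[/andP[-> ->] ->].
Qed.

(** At a common nonzero [u] of the three subspaces, [d * (b + c - a) * f u u] is a sum of three
    nonnegative terms, one per operator. The sign [d] covers both inequalities, with [A] bounded on
    the opposite side. *)
Lemma weyl_of_rayleigh_bounds (A B C : 'End(E)) (U V W : {vspace E}) (d a b c : R) :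
  d != 0 -> A = (B + C)%VF ->
  rayleigh_bound A (- d) a U -> rayleigh_bound B d b V ->
  rayleigh_bound C d c W ->
  (\dim {:E} + \dim {:E} < \dim U + \dim V + \dim W)%N ->
  0 <= d * (b + c - a) /\
  (a = b + c <-> exists u, [/\ u != 0, A u = a *: u, B u = b *: u & C u = c *: u]).
Proof.
move=> d0 AE hU hV hW /cap3_neq0[u [u0 /hU[A1 A2] /hV[B1 B2] /hW[C1 C2]]].
have sumE : (b + c - a) * f u u
    = f (b *: u - B u) u + f (c *: u - C u) u - f (a *: u - A u) u.
  by rewrite AE add_lfunE !(innerBl fP, innerDl fP, innerZl fP); ring.
split.
  rewrite -(pmulr_lge0 _ (inner_gt0 fP u0)) -mulrA sumE.
  by move: A1 B1 C1; rewrite mulNr mulrBr mulrDr; lra.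
split=> [aE|[v [v0 Av Bv Cv]]]; last first.
  have : (a - (b + c)) *: v == 0.
    by rewrite scalerBl scalerDl -Av -Bv -Cv AE add_lfunE subrr.
  by rewrite scaler_eq0 (negPf v0) orbF subr_eq0 => /eqP.
have : d * f (b *: u - B u) u + d * f (c *: u - C u) u
       + - d * f (a *: u - A u) u = 0.
  by rewrite mulNr -mulrDr -mulrBr -sumE aE subrr mul0r mulr0.
move=> /eqP; rewrite !paddr_eq0 ?addr_ge0 // !mulf_eq0 oppr_eq0 (negPf d0) /=.
move=> /andP[/andP[/eqP/B2 Bu /eqP/C2 Cu] /eqP/A2 Au].
by exists u.
Qed.

Context (A B C : 'End(E)).
Hypotheses (AE : A = (B + C)%VF) (Bsa : self_adjoint B) (Csa : self_adjoint C).

Let Asa : self_adjoint A.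
Proof.
by move=> u v; rewrite AE !add_lfunE innerDl // innerDr // Bsa Csa.
Qed.

Local Notation N := (\dim {:E}).

Lemma weyl_le (i j : nat) : (1 <= i <= N)%N -> (j <= N - i)%N ->
  eigenval A i <= eigenval B (i + j) + eigenval C (N - j) /\
  (eigenval A i = eigenval B (i + j) + eigenval C (N - j) <->
   exists u, [/\ u != 0, A u = eigenval A i *: u,
     B u = eigenval B (i + j) *: u & C u = eigenval C (N - j) *: u]).
Proof.
move=> iN jN.
have [//|U dU hU] := rayleigh_above Asa (k := i).
have [|V dV hV] := rayleigh_below Bsa (k := i + j); first lia.
have [|W dW hW] := rayleigh_below Csa (k := N - j); first lia.
(* The dimensions exceed [N - i], and reach [i + j] and [N - j]: their sum exceeds [2N]. *)
have [|le eqE] := weyl_of_rayleigh_bounds (oner_neq0 R) AE hU hV hW; first lia.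
by split=> //; move: le; rewrite mul1r subr_ge0.
Qed.

Lemma weyl_ge (i j : nat) : (1 <= i <= N)%N -> (1 <= j <= i)%N ->
  eigenval A i >= eigenval B (i - j + 1) + eigenval C j /\
  (eigenval A i = eigenval B (i - j + 1) + eigenval C j <->
   exists u, [/\ u != 0, A u = eigenval A i *: u,
     B u = eigenval B (i - j + 1) *: u & C u = eigenval C j *: u]).
Proof.
move=> /andP[i1 iN] /andP[j1 ji].
have [|U dU hU] := @rayleigh_below A Asa i; first by rewrite i1.
have [|V dV hV] := @rayleigh_above B Bsa (i - j + 1); first lia.
have [|W dW hW] := @rayleigh_above C Csa j; first lia.
(* Here [d = -1], so the factor [1] in the bound for [A] must read [- d]. *)
rewrite -{1}[1]opprK in hU.
have [||le eqE] := weyl_of_rayleigh_bounds _ AE hU hV hW; last first.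
- by split=> //; move: le; rewrite mulN1r oppr_ge0 subr_le0.
- lia.
- by rewrite oppr_eq0 oner_eq0.
Qed.

End SelfAdjoint.

(** * Weighted inner products on function spaces *)

Lemma sum_sig (R : nmodType) (V : finType) (P : pred V) (F : V -> R) :
  \sum_(x : {x | P x}) F (val x) = \sum_(x | P x) F x.
Proof. exact/esym/(big_sub P). Qed.

Lemma dim_fct (R : rcfType) (S : finType) : \dim {:fct R S} = #|S|.
Proof. by rewrite dimvf /dim /= muln1. Qed.

Definition wdot (R : rcfType) (S : finType) (m : S -> R) (u v : fct R S) : R :=
  \sum_x m x * (u x * v x).

Lemma wdot_inner (R : rcfType) (S : finType) (m : S -> R) :
  (forall x, 0 < m x) -> inner_product (wdot m).
Proof.
move=> m_gt0; split=> [a u v w|u v|u].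
- rewrite /wdot mulr_sumr -big_split /=; apply: eq_bigr => x _.
  rewrite !ffunE /= -[a *: u x]/(a * u x); ring.
- by apply: eq_bigr => x _; rewrite [u x * _]mulrC.
have ge0 x : 0 <= m x * (u x * u x).
  by rewrite mulr_ge0 ?(ltW (m_gt0 x)) // -expr2 sqr_ge0.
move=> u0; rewrite lt_def sumr_ge0 ?andbT //; apply: contra u0.
rewrite psumr_eq0 // => /allP u0; apply/eqP/ffunP => x; rewrite ffunE.
have := u0 x (mem_index_enum _).
by rewrite !mulf_eq0 gt_eqF //= orbb => /eqP.
Qed.

(** Green's formula: the summands differ by [u x * v y * c x y - u y * v x * c x y], which is
    antisymmetric in [x] and [y]. *)
Lemma sum_diff_sym (R : comNzRingType) (S : finType) (c : S -> S -> R)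
    (u v : S -> R) : (forall x y, c x y = c y x) ->
  \sum_x \sum_y (u x - u y) * c x y * v x
  = \sum_x \sum_y u x * ((v x - v y) * c x y).
Proof.
move=> cC; apply/eqP; rewrite -subr_eq0 -sumrB.
have E x : \sum_y (u x - u y) * c x y * v x - \sum_y u x * ((v x - v y) * c x y)
    = \sum_y u x * v y * c x y - \sum_y u y * v x * c x y.
  by rewrite -!sumrB; apply: eq_bigr => y _; ring.
rewrite (eq_bigr _ (fun x _ => E x)) sumrB [X in _ - X]exchange_big subr_eq0 /=.
by apply/eqP; do 2![apply: eq_bigr => ? _]; rewrite cC.
Qed.

(** * Self-adjointness of the graph operators and decomposition of the Neumann Laplacian *)

Section Graph.
Context (R : rcfType) (V : finType) (G : wgraph R V) (B : {set V}).

Local Notation m := (msr G).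
Local Notation w := (wt G).
Local Notation dotI := (wdot (fun x : int_pts B => m (val x))).
Local Notation dotB := (wdot (fun x : bd_pts B => m (val x))).

Let m_mulK x (a : R) : m x * ((m x)^-1 * a) = a.
Proof. by rewrite mulVKf // gt_eqF ?msr_gt0. Qed.

Lemma dotI_inner : inner_product dotI.
Proof. by apply: wdot_inner => x; apply: msr_gt0. Qed.

Lemma dotB_inner : inner_product dotB.
Proof. by apply: wdot_inner => x; apply: msr_gt0. Qed.

Lemma lap_self_adjoint : self_adjoint (wdot m) (lap G).
Proof.
move=> u v; rewrite /wdot.
under eq_bigr do rewrite lfunE /= ffunE mulrA m_mulK mulr_suml.
under [RHS]eq_bigr do rewrite lfunE /= ffunE mulrCA m_mulK mulr_sumr.
by apply: sum_diff_sym => x y; apply: wt_sym.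
Qed.

Lemma lap_int_self_adjoint : self_adjoint dotI (lap_int G B).
Proof.
move=> u v; rewrite /wdot.
under eq_bigr do rewrite lfunE /= ffunE mulrA m_mulK mulr_suml.
under [RHS]eq_bigr do rewrite lfunE /= ffunE mulrCA m_mulK mulr_sumr.
apply: (sum_diff_sym (c := fun x y : int_pts B => w (val x) (val y))) => x y.
exact: wt_sym.
Qed.

(** The measures cancel, leaving one double sum weighted by the symmetric [w]. This adjointness
    makes the second term of [opT] self-adjoint. *)
Lemma adjB_adjI (f : fct R (bd_pts B)) (u : fct R (int_pts B)) :
  dotI (adjB G B f) u = dotB f (adjI G B u).
Proof.
rewrite /wdot.
under eq_bigr do rewrite lfunE /= ffunE mulrA m_mulK mulr_suml.
under [RHS]eq_bigr do rewrite lfunE /= ffunE mulrCA m_mulK mulr_sumr.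
rewrite exchange_big /=; do 2![apply: eq_bigr => ? _].
by rewrite wt_sym; ring.
Qed.

Lemma ext0_in (P : pred V) (u : fct R {x | P x}) (x : {x | P x}) :
  ext0 R P u (val x) = u x.
Proof. by rewrite lfunE /= ffunE valK. Qed.

Lemma ext0_out (P : pred V) (u : fct R {x | P x}) x :
  ~~ P x -> ext0 R P u x = 0.
Proof. by move=> /negPf Px; rewrite lfunE /= ffunE insubF. Qed.

Lemma sum_ext0 (P : pred V) (u : fct R {x | P x}) (F : V -> R) :
  \sum_x ext0 R P u x * F x = \sum_(x : {x | P x}) u x * F (val x).
Proof.
under [RHS]eq_bigr do rewrite -ext0_in.
rewrite (sum_sig P (fun x => ext0 R P u x * F x)) [RHS]big_mkcond.
by apply: eq_bigr => x _; case: ifPn => // /ext0_out->; rewrite mul0r.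
Qed.

(** Gives minus [adjI] on the boundary and minus [adjB] on the interior, according to the choice of
    [P]. *)
Lemma lap_ext0_out (P : pred V) (u : fct R {x | P x}) x : ~~ P x ->
  lap G (ext0 R P u) x
  = - ((m x)^-1 * \sum_(y : {x | P x}) u y * w x (val y)).
Proof.
move=> Px; rewrite lfunE /= ffunE ext0_out // -sum_ext0 -mulrN -sumrN.
by congr (_ * _); apply: eq_bigr => y _; rewrite sub0r mulNr.
Qed.

(** Interior neighbours contribute [lap_int]; boundary neighbours, where the extension vanishes,
    contribute the degree term. *)
Lemma lap_ext0_int (u : fct R (int_pts B)) (x : int_pts B) :
  lap G (ext0 R (fun x => x \notin B) u) (val x)
  = lap_int G B u x + mul_degB G B u x.
Proof.
rewrite [lap _ _]lfunE [lap_int _ _ _]lfunE [mul_degB _ _ _]lfunE /= !ffunE.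
rewrite /degB -mulrA -mulrDr; congr (_ * _).
rewrite (bigID (fun y => y \notin B)) /= -sum_sig mulr_suml ext0_in.
congr (_ + _); first by apply: eq_bigr => y _; rewrite ext0_in.
rewrite (sum_sig (fun y => y \in B) (fun y => w (val x) y * u x)).
apply: eq_big => [y|y]; rewrite negbK // => yB.
by rewrite ext0_out ?negbK // subr0 mulrC.
Qed.

(** [lap_dir] is the compression of [lap] to functions supported on [B], and inherits its
    symmetry. *)
Lemma lap_dir_self_adjoint : self_adjoint dotB (lap_dir G B).
Proof.
move=> f g; have sE := lap_self_adjoint.
have H (a b : fct R (bd_pts B)) : wdot m (ext0 R (fun x => x \in B) a)
    (lap G (ext0 R (fun x => x \in B) b)) = dotB a (lap_dir G B b).
  rewrite /wdot (eq_bigr _ (fun x _ => mulrCA _ _ _)) sum_ext0.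
  apply: eq_bigr => x _; rewrite mulrCA.
  by rewrite /lap_dir !comp_lfunE [restr _ _ _]lfunE /= ffunE.
by rewrite -H -sE (inner_sym (wdot_inner (msr_gt0 G))) H (inner_sym dotB_inner).
Qed.

Context (meet_int : components_meet_interior G B).

Lemma opT_self_adjoint : self_adjoint dotI (opT G B).
Proof.
pose L := lap_dir G B; have LVK : cancel (L^-1)%VF L.
  exact: lker0_lfunVK (lker_lap_dir meet_int).
have Lsa a b : dotB ((L^-1)%VF a) b = dotB a ((L^-1)%VF b).
  by rewrite -{1}[b]LVK -lap_dir_self_adjoint LVK.
move=> u v; rewrite /opT !add_lfunE !opp_lfunE !comp_lfunE -/L.
rewrite !(innerBl dotI_inner) (inner_sym dotI_inner u) (innerBl dotI_inner).
rewrite !adjB_adjI Lsa (inner_sym dotB_inner); congr (_ - _).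
by apply: eq_bigr => x _; rewrite !lfunE /= !ffunE; ring.
Qed.

Lemma lap_neuE : lap_neu G B = (lap_int G B + opT G B)%VF.
Proof.
apply/lfunP => u; set n := neumann_ext G B u.
have [nI nB] := (neumann_extP meet_int u n).1 erefl.
pose f := restr R (fun x => x \in B) n.
(* Split the Neumann extension into its boundary values [f] and interior values [u]. *)
have nE : n = ext0 R (fun x => x \in B) f + ext0 R (fun x => x \notin B) u.
  apply/ffunP => x; rewrite ffunE; have [xB|xB] := boolP (x \in B).
    rewrite [X in _ + X]ext0_out ?negbK //.
    by rewrite -[x]/(val (Sub x xB : bd_pts B)) ext0_in addr0 /f lfunE /= ffunE.
  rewrite [X in X + _]ext0_out // add0r.
  by rewrite -[x]/(val (Sub x xB : int_pts B)) ext0_in nI.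
(* Harmonicity on [B] reads [lap_dir f = adjI u], which determines [f]. *)
have fE : f = ((lap_dir G B)^-1)%VF (adjI G B u).
  apply: (can_inj (lker0_lfunK (lker_lap_dir meet_int))).
  rewrite (lker0_lfunVK (lker_lap_dir meet_int)); apply/ffunP => x.
  have := nB _ (valP x).
  rewrite nE linearD ffunE /= [X in _ + X]lap_ext0_out ?negbK ?(valP x) // => /eqP.
  rewrite subr_eq0 /lap_dir !comp_lfunE [restr _ _ _]lfunE /= ffunE => /eqP->.
  by rewrite lfunE /= ffunE.
(* At an interior point, the part from [f] gives [- adjB f] and the part from [u] gives
   [lap_int u + mul_degB u]. *)
apply/ffunP => x; rewrite /lap_neu 2!comp_lfunE -/n [restr _ _ _]lfunE /= ffunE.
rewrite nE linearD ffunE /= lap_ext0_int lap_ext0_out ?(valP x) //.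
rewrite add_lfunE /opT add_lfunE opp_lfunE !comp_lfunE -fE !ffunE.
by rewrite [adjB _ _ _]lfunE /= ffunE addrC addrA.
Qed.

End Graph.

Theorem theorem5p2 (R : rcfType) (V : finType) (G : wgraph R V) (B : {set V})
    (B_neq0 : B != set0) (meet_int : components_meet_interior G B) :
  let N := #|~: B| in
  let nu := eigenval (lap_neu G B) in
  let mu := eigenval (lap_int G B) in
  let lam := eigenval (opT G B) in
  (forall i j : nat, (1 <= i <= N)%N -> (j <= N - i)%N ->
     nu i <= mu (i + j)%N + lam (N - j)%N /\
     (nu i = mu (i + j)%N + lam (N - j)%N <->
      exists u : fct R (int_pts B),
        [/\ u != 0, lap_neu G B u = nu i *: u,
            lap_int G B u = mu (i + j)%N *: u
          & opT G B u = lam (N - j)%N *: u])) /\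
  (forall i j : nat, (1 <= i <= N)%N -> (1 <= j <= i)%N ->
     nu i >= mu (i - j + 1)%N + lam j /\
     (nu i = mu (i - j + 1)%N + lam j <->
      exists u : fct R (int_pts B),
        [/\ u != 0, lap_neu G B u = nu i *: u,
            lap_int G B u = mu (i - j + 1)%N *: u
          & opT G B u = lam j *: u])).
Proof.
move=> N nu mu lam.
have -> : N = \dim {:fct R (int_pts B)}.
  rewrite dim_fct card_sig; apply: eq_card => x.
  by rewrite !inE.
have nuE := lap_neuE meet_int; have Bsa := @lap_int_self_adjoint R V G B.
have Csa := opT_self_adjoint meet_int.
(* Both parts are Weyl's inequalities for [lap_neu = lap_int + opT] in the inner product weighted by
   [msr G]. *)
split=> i j; first exact: (weyl_le (dotI_inner G B) nuE Bsa Csa).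
exact: (weyl_ge (dotI_inner G B) nuE Bsa Csa).
Qed.
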